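(* Let $G$ be a connected $(P_7,C_7,C_4,\text{diamond})$-free graph. Then at least one of the following holds: $G$ is the Petersen graph; $G$ has a clique-cutset; $G$ has a vertex of degree at most $\omega(G)$.
   Context: All graphs are finite and simple. $P_\ell$ and $C_\ell$ denote the chordless path and chordless cycle on $\ell$ vertices. The diamond is the complete graph on four vertices minus an edge. A graph is $(L_1,L_2,\ldots)$-free if it has no induced subgraph isomorphic to any $L_i$. A clique-cutset of $G$ is a clique $K$ in $G$ such that $G\setminus K$ has more connected components than $G$. $\omega(G)$ is the size of a largest clique of $G$. *)

(* Defs.v *)
From mathcomp Require Import all_boot.

Set Implicit Arguments.
Unset Strict Implicit.
Unset Printing Implicit Defensive.

Record sgraph := SGraph {
  vertex :> finType;
  edge : rel vertex;
  edge_sym : symmetric edge;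
  edge_irr : irreflexive edge
}.

Definition graph_iso (G H : sgraph) : Prop :=
  exists f : G -> H, bijective f /\ forall x y, edge (f x) (f y) = edge x y.

Section Induced.
Variables (G : sgraph) (S : {set G}).

Definition induced_edge : rel {x : G | x \in S} :=
  [rel x y | edge (val x) (val y)].

Lemma induced_edge_sym : symmetric induced_edge.
Proof. by move=> x y; rewrite /induced_edge /= edge_sym. Qed.

Lemma induced_edge_irr : irreflexive induced_edge.
Proof. by move=> x; rewrite /induced_edge /= edge_irr. Qed.

Definition induced : sgraph := SGraph induced_edge_sym induced_edge_irr.

End Induced.

Definition induced_free (L G : sgraph) : Prop :=
  ~ exists S : {set G}, graph_iso (induced S) L.

(* The graph with no vertices is not connected. *)
Definition connected_graph (G : sgraph) : Prop :=
  0 < #|G| /\ forall x y : G, connect (@edge G) x y.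

Definition num_components (G : sgraph) : nat := n_comp (@edge G) G.

Definition is_clique (G : sgraph) (K : {set G}) : bool :=
  [forall x in K, forall y in K, (x != y) ==> edge x y].

Definition clique_number (G : sgraph) : nat :=
  \max_(K : {set G} | is_clique K) #|K|.

Definition is_clique_cutset (G : sgraph) (K : {set G}) : Prop :=
  is_clique K /\ num_components G < num_components (induced (~: K)).

Definition degree (G : sgraph) (x : G) : nat := #|[set y | edge x y]|.

Section PathGraph.
Variable l : nat.

Definition path_edge : rel 'I_l :=
  [rel i j : 'I_l | (i.+1 == j :> nat) || (j.+1 == i :> nat)].

Lemma path_edge_sym : symmetric path_edge.
Proof. by move=> i j; rewrite /path_edge /= orbC. Qed.

Lemma path_edge_irr : irreflexive path_edge.
Proof. by move=> i; rewrite /path_edge /= orbb; apply: gtn_eqF. Qed.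

Definition path_graph : sgraph := SGraph path_edge_sym path_edge_irr.

End PathGraph.

(* [ordS] is the successor modulo l. This is the cycle for 3 <= l; the test
   i != j only matters for l = 1, where it rules out a loop. *)
Section CycleGraph.
Variable l : nat.

Definition cycle_edge : rel 'I_l :=
  [rel i j : 'I_l | (i != j) && ((ordS i == j) || (ordS j == i))].

Lemma cycle_edge_sym : symmetric cycle_edge.
Proof. by move=> i j; rewrite /cycle_edge /= eq_sym orbC. Qed.

Lemma cycle_edge_irr : irreflexive cycle_edge.
Proof. by move=> i; rewrite /cycle_edge /= eqxx. Qed.

Definition cycle_graph : sgraph := SGraph cycle_edge_sym cycle_edge_irr.

End CycleGraph.

(* The missing edge of the diamond joins 0 and 1. *)
Definition diamond_edge : rel 'I_4 :=
  [rel i j : 'I_4 | (i != j) && ~~ ((i < 2) && (j < 2))].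

Lemma diamond_edge_sym : symmetric diamond_edge.
Proof. by move=> i j; rewrite /diamond_edge /= eq_sym [(i < 2) && _]andbC. Qed.

Lemma diamond_edge_irr : irreflexive diamond_edge.
Proof. by move=> i; rewrite /diamond_edge /= eqxx. Qed.

Definition diamond : sgraph := SGraph diamond_edge_sym diamond_edge_irr.

(* The Petersen graph as the Kneser graph K(5, 2): 2-subsets of a 5-set,
   adjacent when disjoint. *)
Definition petersen_edge : rel {A : {set 'I_5} | #|A| == 2} :=
  [rel A B : {A : {set 'I_5} | #|A| == 2} | [disjoint val A & val B]].

Lemma petersen_edge_sym : symmetric petersen_edge.
Proof. by move=> A B; rewrite /petersen_edge /= disjoint_sym. Qed.

Lemma petersen_edge_irr : irreflexive petersen_edge.
Proof.
move=> [A cardA]; apply/negbTE; rewrite /petersen_edge /= -setI_eq0 setIid.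
by rewrite -cards_eq0 (eqP cardA).
Qed.

Definition petersen : sgraph := SGraph petersen_edge_sym petersen_edge_irr.

(* Main.v *)
(* If every degree exceeds omega(G), then every edge uv has at least two
   neighbours of v outside N[u]: as G is (C4, diamond)-free, u, v and their
   common neighbours form a clique.
   Starting from one edge, take the newest known vertex v with an edge uv for
   which fewer than two such neighbours are known, add a new one and branch
   over its adjacencies to the known vertices that create no induced C4,
   diamond, C7 or P7. This exhaustive search, run by computation, is finite:
   each branch dies, or reaches a Petersen graph, and a further vertex adjacent
   to that Petersen graph only leads to dead branches. *)

Require Import Defs.
From mathcomp Require Import all_boot.

Set Implicit Arguments.
Unset Strict Implicit.
Unset Printing Implicit Defensive.

(** * Adjacency codes and induced subgraphs *)

(* A graph on a list of vertices is encoded by the strict upper triangle of its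
   adjacency matrix; adding a vertex at the head only adds a first row. *)
Section Codes.

Variables (T : Type) (e : rel T).

Fixpoint code (s : seq T) : seq (seq bool) :=
  if s is x :: s' then [seq e x y | y <- s'] :: code s' else [::].

Lemma size_code s : size (code s) = size s.
Proof. by elim: s => //= x s ->. Qed.

End Codes.

Lemma code_map (T U : Type) (f : T -> U) (e : rel U) s :
  code e (map f s) = code (relpre f e) s.
Proof. by elim: s => //= x s ->; rewrite -map_comp. Qed.

Lemma eq_in_code (T : eqType) (e e' : rel T) (s : seq T) :
  {in s &, e =2 e'} -> code e s = code e' s.
Proof.
elim: s => //= x s IHs ee'; congr (_ :: _).
  by apply/eq_in_map => y ys; rewrite ee' ?mem_head ?inE ?ys ?orbT.
by apply: IHs => y z ys zs; rewrite ee' ?inE ?ys ?zs ?orbT.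
Qed.

Fixpoint square (A : seq (seq bool)) : seq (seq bool) :=
  if A is r :: A' then
    (false :: r) :: [seq p.1 :: p.2 | p <- zip r (square A')]
  else [::].

Definition entry (M : seq (seq bool)) (i j : nat) : bool :=
  nth false (nth [::] M i) j.

Lemma square_code (G : sgraph) (s : seq G) :
  square (code (@edge G) s) = [seq [seq edge x y | y <- s] | x <- s].
Proof.
elim: s => //= x s ->; rewrite edge_irr zip_map -map_comp; congr (_ :: _).
by apply: eq_map => y /=; rewrite edge_sym.
Qed.

Lemma entry_code (G : sgraph) (x0 : G) (s : seq G) i j :
  i < size s -> j < size s ->
  entry (square (code (@edge G) s)) i j = edge (nth x0 s i) (nth x0 s j).
Proof.
by move=> lti ltj; rewrite square_code /entry (nth_map x0) ?(nth_map x0).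
Qed.

(** Equal codes mean equal adjacency matrices, so sending the vertex at each position of [t] to the
    one at the same position of [s] preserves adjacency. The vertex of [G] is only a default for
    [nth]. *)
Lemma code_embedding (G H : sgraph) (s : seq G) (t : seq H) :
  uniq s -> (forall z, z \in t) -> code (@edge G) s = code (@edge H) t ->
  G -> exists2 f : H -> G, injective f & forall y z, edge (f y) (f z) = edge y z.
Proof.
move=> Us tH eq_st x0.
have ltt z : index z t < size t by rewrite index_mem.
have lts z : index z t < size s.
  by rewrite -(size_code (@edge G)) eq_st size_code.
exists (fun z => nth x0 s (index z t)) => [y z /eqP | y z].
  by rewrite nth_uniq // => /eqP/(congr1 (nth y t)); rewrite !nth_index.
by rewrite -!entry_code // eq_st (entry_code y) // !nth_index.
Qed.

Lemma embedding_not_free (L G : sgraph) (f : L -> G) :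
  injective f -> (forall y z, edge (f y) (f z) = edge y z) -> ~ induced_free L G.
Proof.
move=> f_inj f_edge; apply; exists [set f z | z : L].
pose g z : induced [set f z | z : L] := exist _ (f z) (imset_f f (isT : z \in L)).
have g_inj : injective g by move=> y z /(congr1 val)/f_inj.
(* The image of [f] has at most as many elements as [L], so the injection [g] is onto. *)
have [h gK hK] : bijective g.
  by apply: inj_card_bij => //; rewrite card_sig (leq_trans (leq_imset_card f L)).
exists h; split=> [|x y]; first by exists g.
by rewrite -f_edge -{2}[x]hK -{2}[y]hK.
Qed.

Lemma code_not_free (L G : sgraph) (s : seq G) (t : seq L) :
  induced_free L G -> (forall z, z \in t) -> 0 < size t ->
  uniq s -> code (@edge G) s <> code (@edge L) t.
Proof.
move=> freeL tL t_gt0 Us eq_st.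
have [x0 _] : exists x0 : G, true.
  by case: s Us eq_st => [_ /(congr1 size)|x0 s]; [case: (t) t_gt0 | exists x0].
have [f f_inj f_edge] := code_embedding Us tL eq_st x0.
by case: (embedding_not_free f_inj f_edge).
Qed.


(** * Forbidden induced subgraphs *)

(** This relation and the next two live on [nat] in order to compute; pulled back along [val] they
    are convertible to the edge relations on ordinals. *)
Definition path_rel : rel nat := [rel i j | (i.+1 == j) || (j.+1 == i)].

Definition cycle_rel (l : nat) : rel nat :=
  [rel i j | (i != j) && ((i.+1 %% l == j) || (j.+1 %% l == i))].

Definition diamond_rel : rel nat :=
  [rel i j | (i != j) && ~~ ((i < 2) && (j < 2))].

Lemma code_path_not_free l (G : sgraph) (s : seq G) : 0 < l ->
  induced_free (path_graph l) G -> uniq s ->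
  code (@edge G) s <> code path_rel (iota 0 l).
Proof.
move=> l_gt0 freeL Us; rewrite -val_enum_ord code_map.
apply: (@code_not_free (path_graph l) G s (enum 'I_l)) => // [z|].
  exact: mem_enum.
by rewrite size_enum_ord.
Qed.

Lemma code_cycle_not_free l (G : sgraph) (s : seq G) : 0 < l ->
  induced_free (cycle_graph l) G -> uniq s ->
  code (@edge G) s <> code (cycle_rel l) (iota 0 l).
Proof.
move=> l_gt0 freeL Us; rewrite -val_enum_ord code_map.
apply: (@code_not_free (cycle_graph l) G s (enum 'I_l)) => // [z|].
  exact: mem_enum.
by rewrite size_enum_ord.
Qed.

Lemma code_diamond_not_free (G : sgraph) (s : seq G) :
  induced_free diamond G -> uniq s ->
  code (@edge G) s <> code diamond_rel (iota 0 4).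
Proof.
move=> freeL Us; rewrite -val_enum_ord code_map.
apply: (@code_not_free diamond G s (enum 'I_4)) => // [z|].
  exact: mem_enum.
by rewrite size_enum_ord.
Qed.

(** Otherwise the four vertices induce a diamond if [a] and [b] are adjacent, and the 4-cycle y, a,
    c, b if not. *)
Lemma common_neighbors_adjacent (G : sgraph) (a b y c : G) :
  induced_free (cycle_graph 4) G -> induced_free diamond G ->
  a != b -> y != c -> edge a y -> edge b y -> edge a c -> edge b c -> edge y c.
Proof.
move=> C4 D neq_ab neq_yc ay byy ac bc; apply/negPn/negP => /negbTE yc.
have neq x z : edge x z -> (x == z) = false.
  by apply: contraTF => /eqP ->; rewrite edge_irr.
have [ya yb ca cb] : [/\ edge y a, edge y b, edge c a & edge c b].
  by rewrite ![edge _ a]edge_sym ![edge _ b]edge_sym.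
case: (boolP (edge a b)) => [ab | /negbTE ab].
  apply: (@code_diamond_not_free G [:: y; c; a; b] D).
    by rewrite /= !inE (negbTE neq_yc) (negbTE neq_ab) !neq.
  by rewrite /= yc ya yb ca cb ab.
apply: (@code_cycle_not_free 4 G [:: y; a; c; b]) => //.
  by rewrite /= !inE (negbTE neq_yc) (negbTE neq_ab) !neq.
by rewrite /= yc ya yb ac ab cb.
Qed.

(** * The exhaustive search *)

(* Under call by value, [&&] evaluates both sides; the conditionals here and
   below keep the computation short. *)
Fixpoint fits (T : Type) (e : rel T) (x : T) (s : seq T) (r : seq bool) : bool :=
  match s, r with
  | y :: s', b :: r' => if e x y == b then fits e x s' r' else false
  | [::], [::] => true
  | _, _ => false
  end.

Lemma fitsE (T : Type) (e : rel T) x s r :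
  fits e x s r = ([seq e x y | y <- s] == r).
Proof.
by elim: s r => [|y s IHs] [|b r] //=; rewrite IHs eqseq_cons; case: eqP.
Qed.

(* The last vertex of each list is chosen first, from R: it roots the copy. *)
Fixpoint copies (T : eqType) (e : rel T) (R V : seq T) (P : seq (seq bool)) :
    seq (seq T) :=
  if P is r :: P' then
    [seq x :: s | s <- copies e R V P',
       x <- [seq x <- if s is [::] then R else V |
               if fits e x s r then x \notin s else false]]
  else [:: [::]].

(** Serves twice: a listed C7 or P7 contradicts freeness, and a listed copy among the duads
    identifies the Petersen graph. *)
Lemma copies_sound (T : eqType) (e : rel T) R V P s :
  {subset R <= V} -> s \in copies e R V P ->
  [/\ uniq s, {subset s <= V} & code e s = P].
Proof.
move=> sRV; elim: P s => [|r P IHP] s /=; first by rewrite inE => /eqP ->.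
move/allpairsPdep => [s' [x []]] /IHP [Us' sV <-]; rewrite mem_filter fitsE.
case: eqP => //= <- /andP[s'x Vx] ->; split=> //=; first by rewrite s'x.
move=> y; rewrite inE => /predU1P[-> | /sV //].
by case: (s') Vx => // /sRV.
Qed.

Definition chordless_C7_P7 : seq (seq (seq bool)) := Eval vm_compute in
  [:: code (cycle_rel 7) (iota 0 7); code path_rel (iota 0 7)].

(* Only the C7s through the newest vertex and the P7s ending there are sought:
   this is enough for the search to succeed. *)
Definition feasible (A : seq (seq bool)) : bool :=
  let e := entry (square A) in
  all (fun P => nilp (copies e [:: 0] (iota 0 (size A)) P)) chordless_C7_P7.

Definition common (e : rel nat) (m a b : nat) : seq nat :=
  [seq c <- iota 0 m | e a c && e b c].

(* Two vertices with a common neighbour besides y can both be adjacent to y only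
   if they are adjacent. *)
Definition compatible (e : rel nat) (m a b : nat) : bool :=
  [|| a == b, e a b | nilp (common e m a b)].

(** Pruning at each insertion avoids enumerating all subsets of [V]. *)
Fixpoint compatible_sets (e : rel nat) (m : nat) (V : seq nat) : seq (seq nat) :=
  if V is a :: V' then
    let C := compatible_sets e m V' in
    C ++ [seq a :: Z | Z <- C & all (compatible e m a) Z]
  else [:: [::]].

Lemma filter_compatible_sets e m (p : pred nat) V :
  {in [seq a <- V | p a] &, forall a b, compatible e m a b} ->
  [seq a <- V | p a] \in compatible_sets e m V.
Proof.
elim: V => //= a V IHV; rewrite mem_cat.
case: ifP => pa comp; last by rewrite IHV.
rewrite map_f ?orbT // mem_filter IHV => [|b c bV cV]; last first.
  by apply: comp; rewrite inE ?bV ?cV orbT.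
by rewrite andbT; apply/allP => b bV; apply: comp; rewrite inE ?eqxx ?bV ?orbT.
Qed.

(** By [common_neighbors_adjacent], a new vertex adjacent to both [a] and [b] is adjacent to all
    their common neighbours. *)
Definition closed_under_common (e : rel nat) (m : nat) (Z : seq nat) : bool :=
  all (fun a => all (fun b => (a == b) || all (mem Z) (common e m a b)) Z) Z.

(* Candidate sets of known neighbours of a new vertex that is adjacent to v and
   to no vertex of X. *)
Definition neighborhoods (e : rel nat) (m v : nat) (X : seq nat) :
    seq (seq nat) :=
  [seq v :: Z | Z <- compatible_sets e m
      [seq i <- iota 0 m | (i \notin v :: X) && compatible e m v i]
    & closed_under_common e m (v :: Z)].

Definition grow (A : seq (seq bool)) (v : nat) (X : seq nat) :
    seq (seq (seq bool)) :=
  let I := iota 0 (size A) in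
  [seq B <- [seq [seq i \in Z | i <- I] :: A
              | Z <- neighborhoods (entry (square A)) (size A) v X]
   | feasible B].

Definition private (e : rel nat) (m v u : nat) : seq nat :=
  [seq w <- iota 0 m | [&& e v w, ~~ e u w & w != u]].

(** Index 0 is the newest vertex, so the head of this list concerns the newest deficient one. *)
Definition deficient (e : rel nat) (m : nat) : seq (nat * nat) :=
  [seq (v, u) | v <- iota 0 m,
     u <- [seq u <- [seq u <- iota 0 m | e v u] | size (private e m v u) < 2]].

Definition disj (p q : nat * nat) : bool :=
  [&& p.1 != q.1, p.1 != q.2, p.2 != q.1 & p.2 != q.2].

(* The 2-subsets {a < b} of {0, ..., 4}, the vertices of the Petersen graph. *)
Definition duads : seq (nat * nat) :=
  [seq (a, b) | b <- iota 0 5, a <- iota 0 b].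

(** Fixing the root at [(0, 1)] loses nothing, the Petersen graph being vertex-transitive. *)
Definition is_petersen (A : seq (seq bool)) : bool :=
  if size A == 10 then ~~ nilp (copies disj [:: (0, 1)] duads A) else false.

(** The fuel [n] bounds the depth, and running out counts as failure. A branch dies when [grow]
    returns no code. *)
Fixpoint search (n : nat) (A : seq (seq bool)) : bool :=
  if n is n'.+1 then
    if deficient (entry (square A)) (size A) is (v, u) :: _ then
      all (search n') (grow A v [:: u])
    else if is_petersen A then
      all (fun v => all (search n') (grow A v [::])) (iota 0 (size A))
    else false
  else false.

(** Starting from one edge, fuel 12 allows graphs of up to 13 vertices. *)
Lemma search_edge : search 12 [:: [:: true]; [::]].
Proof. by vm_cast_no_check (erefl true). Qed.

(** * Soundness of the search *)

Section Search.

Variable G : sgraph.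
Hypothesis GP7 : induced_free (path_graph 7) G.
Hypothesis GC7 : induced_free (cycle_graph 7) G.
Hypothesis GC4 : induced_free (cycle_graph 4) G.
Hypothesis Gdiamond : induced_free diamond G.

Implicit Types (x y : G) (s : seq G).

Local Notation code := (code (@edge G)).

Lemma feasible_code s : uniq s -> feasible (code s).
Proof.
(* Nonemptiness of [s] makes the root 0 a valid index. *)
case: s => // x0 s0; set s := x0 :: s0 => Us.
apply/allP => P PP; rewrite size_code.
case E: copies => [//|p C].
have : p \in p :: C by exact: mem_head.
rewrite -E => /copies_sound[|Up pI code_p].
  by move=> i; rewrite inE => /eqP->.
have lt_p i : i \in p -> i < size s by move/pI; rewrite mem_iota.
have Ut : uniq [seq nth x0 s i | i <- p].
  rewrite map_inj_in_uniq // => i j /lt_p ? /lt_p ? /eqP.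
  by rewrite nth_uniq // => /eqP.
have code_t : code [seq nth x0 s i | i <- p] = P.
  rewrite code_map -code_p; apply: eq_in_code => i j /lt_p ? /lt_p ?.
  by rewrite (entry_code x0).
move: PP; rewrite !inE => /orP[] /eqP eP.
  by case: (@code_cycle_not_free 7 G _ isT GC7 Ut); rewrite code_t eP.
by case: (@code_path_not_free 7 G _ isT GP7 Ut); rewrite code_t eP.
Qed.

(** Completeness of the branching: the true adjacencies of [y] to [s] pass every filter. *)
Lemma grow_code s y v X :
    uniq s -> y \notin s -> v < size s ->
    edge y (nth y s v) -> (forall u, u \in X -> ~~ edge y (nth y s u)) ->
  code (y :: s) \in grow (code s) v X.
Proof.
move=> Us ys ltv yv yX; set e := entry (square (code s)).
have e_edge i j :
    i < size s -> j < size s -> e i j = edge (nth y s i) (nth y s j).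
  exact: entry_code.
have y_common a b c : a < size s -> b < size s -> edge y (nth y s a) ->
    edge y (nth y s b) -> a != b -> c \in common e (size s) a b ->
    edge y (nth y s c) /\ edge (nth y s a) (nth y s b).
  move=> lta ltb ya yb neq_ab.
  rewrite mem_filter mem_iota add0n => /andP[/andP[ac bc] /= ltc].
  rewrite e_edge // in ac; rewrite e_edge // in bc.
  have neq_yc : y != nth y s c by apply: contraNneq ys => ->; rewrite mem_nth.
  have neq_ab' : nth y s a != nth y s b by rewrite nth_uniq.
  have [ay byy] : edge (nth y s a) y /\ edge (nth y s b) y.
    by split; rewrite edge_sym.
  (* The lemma applies twice with roles exchanged: first [y] and [c] are the common neighbours of
     [a] and [b], then [a] and [b] are those of [y] and [c]. *)
  have yc := common_neighbors_adjacent GC4 Gdiamond neq_ab' neq_yc ay byy ac bc.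
  split=> //; apply: (common_neighbors_adjacent GC4 Gdiamond neq_yc neq_ab') => //.
    by rewrite edge_sym.
  by rewrite edge_sym.
have comp a b : a < size s -> b < size s -> edge y (nth y s a) ->
    edge y (nth y s b) -> compatible e (size s) a b.
  move=> lta ltb ya yb; apply/or3P.
  have [-> | neq_ab] := eqVneq a b; first exact: Or31.
  case E: (common e (size s) a b) => [|c C]; first exact: Or33.
  have [] := y_common a b c lta ltb ya yb neq_ab; first by rewrite E mem_head.
  by rewrite -e_edge // => _ ab; apply: Or32.
pose V := [seq i <- iota 0 (size s) |
             (i \notin v :: X) && compatible e (size s) v i].
pose Z := [seq i <- V | edge y (nth y s i)].
have ZP i : i < size s -> (i \in v :: Z) = edge y (nth y s i).
  move=> lti; rewrite inE; have [-> | neq_iv] := eqVneq i v; first by rewrite yv.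
  rewrite !mem_filter mem_iota leq0n lti andbT inE (negbTE neq_iv) /=.
  case: (boolP (edge y _)) => //= yi; rewrite comp // !andbT.
  by apply: contraL yi; apply: yX.
have ltZ i : i \in v :: Z -> i < size s.
  by rewrite inE => /predU1P[-> //|]; rewrite !mem_filter mem_iota => /and3P[].
have code_ys :
    code (y :: s) = [seq i \in v :: Z | i <- iota 0 (size (code s))] :: code s.
  congr (_ :: _); rewrite size_code -[in LHS](mkseq_nth y s) /mkseq -map_comp.
  by apply/eq_in_map => i; rewrite mem_iota => /= /ZP ->.
rewrite mem_filter feasible_code /= ?ys //.
rewrite -/(code (y :: s)) code_ys; apply/mapP; exists (v :: Z) => //; apply/map_f.
rewrite size_code mem_filter filter_compatible_sets ?andbT => [|a b]; last first.
  rewrite !mem_filter !mem_iota => /and3P[ya _ lta] /and3P[yb _ ltb].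
  exact: comp.
apply/allP => a aZ; apply/allP => b bZ.
have [//|neq_ab /=] := eqVneq a b; apply/allP => c cab.
have ltc : c < size s by move: cab; rewrite mem_filter mem_iota => /andP[].
have [lta ltb] := (ltZ a aZ, ltZ b bZ); rewrite ZP // in aZ; rewrite ZP // in bZ.
change (c \in v :: Z); rewrite ZP //.
by have [] := y_common a b c lta ltb aZ bZ neq_ab cab.
Qed.

Hypothesis G_private : forall u v : G, edge u v ->
  1 < #|[set w | [&& edge v w, ~~ edge u w & w != u]]|.

(** At least two private neighbours exist in [G] and fewer than two in [s], so one lies outside [s].
    The default [x0] stays arbitrary because [grow_code] uses the new vertex as default. *)
Lemma deficient_private s v u : uniq s ->
    (v, u) \in deficient (entry (square (code s))) (size s) ->
  [/\ v < size s, u < size s & exists2 y, y \notin s &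
      forall x0, edge y (nth x0 s v) /\ ~~ edge y (nth x0 s u)].
Proof.
move=> Us /allpairsPdep[v' [u' [vI]]]; rewrite !mem_filter => uI [-> ->].
move: vI uI; rewrite !mem_iota => /= ltv /and3P[few vu ltu]; split=> //.
case: s Us ltv vu ltu few => // x0 s0; set s := x0 :: s0 => Us ltv vu ltu few.
rewrite (entry_code x0) // edge_sym in vu.
set W := [set w | [&& edge (nth x0 s v') w, ~~ edge (nth x0 s u') w
                    & w != nth x0 s u']].
set pvu := private _ _ _ _ in few.
have /subsetPn [y] : ~~ (W \subset [seq nth x0 s w | w <- pvu]).
  apply: contraL few => /subset_leq_card leW; rewrite -leqNgt.
  rewrite (leq_trans (G_private vu)) // (leq_trans leW) //.
  by rewrite (leq_trans (card_size _)) // size_map.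
rewrite inE => /and3P[vy uy neq_yu] ynot.
exists y => [|x1]; last first.
  by rewrite !(set_nth_default x0) // ![edge y _]edge_sym.
apply: contra ynot => ys; apply/mapP.
exists (index y s); last by rewrite nth_index.
rewrite mem_filter mem_iota leq0n index_mem ys andbT.
rewrite !(entry_code x0) ?index_mem // nth_index //.
by rewrite vy uy !andbT; apply: contra_neq neq_yu => <-; rewrite nth_index.
Qed.

(** The run is followed inside [G], by induction on the fuel: as long as some pair is deficient or
    an edge leaves [s], a vertex of [G] extends [s] along a branch of the search. *)
Lemma search_sound n s : uniq s -> search n (code s) ->
  exists t : seq G, [/\ uniq t, is_petersen (code t)
    & forall x y, x \in t -> edge x y -> y \in t].
Proof.
elim: n s => //= n IHn s Us; rewrite size_code.
case E: (deficient _ _) => [|[v u] D].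
  case: ifP => // pet /allP all_s.
  (* Either an edge leaves the Petersen graph on [s] and the search goes on, or [s] is closed under
     adjacency. *)
  have [/existsP[x /existsP[y /and3P[xy xs ys]]] | noxy] :=
    boolP [exists x, exists y, [&& edge x y, x \in s & y \notin s]].
    have /all_s/allP/(_ (code (y :: s))) : index x s \in iota 0 (size s).
      by rewrite mem_iota add0n index_mem.
    move=> searchy; apply: (IHn (y :: s)); first by rewrite /= ys.
    apply: searchy; apply: grow_code => //; rewrite ?index_mem ?nth_index //.
    by rewrite edge_sym.
  exists s; split=> // x y xs xy; apply: contraR noxy => ys.
  by apply/existsP; exists x; apply/existsP; exists y; rewrite xy xs.
move=> /allP all_s.
have [|ltv ltu [y ys yvu]] := @deficient_private s v u Us.
  by rewrite E mem_head.
apply: (IHn (y :: s)); first by rewrite /= ys.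
apply: all_s; apply: grow_code => //; first by case: (yvu y).
by move=> i; rewrite inE => /eqP ->; case: (yvu y).
Qed.

End Search.

(** * Recognition of the Petersen graph *)

Lemma card_petersen : #|petersen| = 10.
Proof.
transitivity 'C(#|'I_5|, 2); last by rewrite card_ord.
by rewrite -card_draws cardsE card_sig; apply: eq_card.
Qed.

(** The duads found give an adjacency-preserving injection into K(5, 2), bijective because both
    graphs have 10 vertices. *)
Lemma is_petersen_iso (G : sgraph) (s : seq G) :
  uniq s -> (forall x, x \in s) -> is_petersen (code (@edge G) s) ->
  graph_iso G petersen.
Proof.
move=> Us sG; rewrite /is_petersen size_code; case: eqP => // size_s.
case E: copies => [//|p C] _.
have : p \in p :: C by exact: mem_head.
rewrite -E => /copies_sound[|Up pD code_p].
  by move=> q; rewrite inE => /eqP->.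
have size_p : size p = 10 by rewrite -(size_code disj) code_p size_code.
have /card_gt0P [z0 _] : 0 < #|petersen| by rewrite card_petersen.
pose duad (q : nat * nat) : petersen := insubd z0 [set inord q.1; inord q.2].
have duadsP q : q \in duads -> [/\ q.1 < q.2, q.1 < 5 & q.2 < 5].
  have /allP Dlt : all (fun q => [&& q.1 < q.2, q.1 < 5 & q.2 < 5]) duads by [].
  by move=> /Dlt/and3P.
have inord_eq a b : a < 5 -> b < 5 -> (inord a == inord b :> 'I_5) = (a == b).
  by move=> lta ltb; rewrite -val_eqE /= !inordK.
have val_duad q : q \in duads -> val (duad q) = [set inord q.1; inord q.2].
  case/duadsP=> lt12 lt1 lt2.
  by rewrite val_insubd cards2 inord_eq // neq_ltn lt12.
have duad_edge : {in p &, disj =2 relpre duad (@edge petersen)}.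
  move=> q r /pD Dq /pD Dr; rewrite /= /petersen_edge /= !val_duad //.
  have [_ q1 q2] := duadsP q Dq; have [_ r1 r2] := duadsP r Dr.
  rewrite -setI_eq0 setIUl setU_eq0 !setI_eq0 !disjoints1 !inE !inord_eq //.
  by rewrite !negb_or -andbA.
have duad_inj : {in p &, injective duad}.
  move=> q r /pD Dq /pD Dr /(congr1 val); rewrite !val_duad // => /setP eq_qr.
  have [q12 q1 q2] := duadsP q Dq; have [r12 r1 r2] := duadsP r Dr.
  (* Each entry of [q] is an entry of [r]; the strict order inside both pairs excludes repetition
     and swapping. *)
  move: (eq_qr (inord q.1)) (eq_qr (inord q.2)).
  rewrite !inE !inord_eq // !eqxx orbT /= => /esym + /esym.
  case: q r q12 r12 {Dq Dr q1 q2 r1 r2 eq_qr} => [a b] [c d] /= ltab ltcd.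
  case/orP=> /eqP ac /orP[] /eqP bd; subst a b; rewrite ?ltnn // in ltab *.
  by rewrite ltnNge ltnW in ltcd.
have [f f_inj f_edge] : exists2 f : G -> petersen, injective f &
    forall x y, edge (f x) (f y) = edge x y.
  apply: (@code_embedding petersen G (map duad p) s _ sG _ z0).
    by rewrite map_inj_in_uniq.
    by rewrite code_map -code_p; apply/esym/eq_in_code.
exists f; split=> //; apply: inj_card_bij => //.
by rewrite card_petersen -size_s -(card_uniqP Us) max_card.
Qed.

(** * Degrees above the clique number, and conclusion *)

Lemma connected_subset_full (G : sgraph) (s : seq G) (x0 : G) :
  connected_graph G -> x0 \in s -> (forall x y, x \in s -> edge x y -> y \in s) ->
  forall x, x \in s.
Proof.
move=> [_ Gconn] sx0 s_closed x; have /connectP[p e_p ->] := Gconn x0 x.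
by elim: p x0 sx0 e_p => //= y p IHp x0 /s_closed s0 /andP[/s0 sy /(IHp _ sy)].
Qed.

(** The clique [K] made of [u], [v] and their common neighbours has at most omega vertices, and
    covers only |K| - 1 of the more than omega neighbours of [v]. *)
Lemma private_neighbors (G : sgraph) (u v : G) :
  induced_free (cycle_graph 4) G -> induced_free diamond G ->
  edge u v -> clique_number G < degree v ->
  1 < #|[set w | [&& edge v w, ~~ edge u w & w != u]]|.
Proof.
move=> GC4 Gdiamond uv; set W := [set w | _].
pose K := [set u; v] :|: [set w | edge u w && edge v w].
have cliqueK : is_clique K.
  apply/forall_inP => x; rewrite !inE => Kx.
  apply/forall_inP => y; rewrite !inE => Ky.
  apply/implyP => neq_xy; have vu : edge v u by rewrite edge_sym.
  have neq_uv : u != v by apply: contraTneq uv => ->; rewrite edge_irr.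
  case/orP: Kx => [/orP[]/eqP xE | /andP[ux vx]];
    case/orP: Ky => [/orP[]/eqP yE | /andP[uy vy]];
    subst; rewrite ?eqxx // in neq_xy *.
  - by rewrite edge_sym.
  - by rewrite edge_sym.
  - exact: (common_neighbors_adjacent GC4 Gdiamond neq_uv neq_xy).
have leK : #|K| <= clique_number G.
  exact: (@leq_bigmax_cond _ (@is_clique G) (fun K => #|K|)).
(* The neighbours of [v] split into those in N[u], which form [K] minus [v], and those in [W]. *)
have -> : degree v = #|K|.-1 + #|W|.
  have Kv : v \in K by rewrite !inE eqxx orbT.
  rewrite (cardsD1 v K) Kv /degree /=.
  rewrite -(cardsID [set w | (w == u) || edge u w] [set w | edge v w]).
  congr (_ + _); apply: eq_card => w; rewrite !inE.
    have [-> | neq_wv /=] := eqVneq w v; first by rewrite edge_irr.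
    have [-> | neq_wu /=] := eqVneq w u; first by rewrite edge_sym uv.
    by rewrite andbC.
  by rewrite negb_or andbC [(w != u) && _]andbC.
have K_gt0 : 0 < #|K| by apply/card_gt0P; exists u; rewrite !inE eqxx.
move=> lt_deg; have := leq_ltn_trans leK lt_deg.
by rewrite -[X in X < _](prednK K_gt0) -addn1 ltn_add2l.
Qed.

Theorem theorem5p3 (G : sgraph)
    (Gconn : connected_graph G)
    (GP7 : induced_free (path_graph 7) G)
    (GC7 : induced_free (cycle_graph 7) G)
    (GC4 : induced_free (cycle_graph 4) G)
    (Gdiamond : induced_free diamond G) :
  graph_iso G petersen \/
  (exists K : {set G}, is_clique_cutset K) \/
  (exists x : G, degree x <= clique_number G).
Proof.
have [/existsP low | /existsPn high] :=
  boolP [exists x, @degree G x <= clique_number G].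
  by right; right.
left; have deg_high (x : G) : clique_number G < degree x by rewrite ltnNge high.
have /card_gt0P[x _] := Gconn.1.
(* A degree above the clique number is positive, which provides the starting edge. *)
have /card_gt0P[y] := leq_ltn_trans (leq0n _) (deg_high x).
rewrite inE => xy; have neq_xy : x != y.
  by apply: contraTneq xy => ->; rewrite edge_irr.
have Gprivate (u v : G) (uv : edge u v) :=
  private_neighbors GC4 Gdiamond uv (deg_high v).
have searchxy : search 12 (code (@edge G) [:: x; y]).
  have -> : code (@edge G) [:: x; y] = [:: [:: true]; [::]] by rewrite /= xy.
  exact: search_edge.
have Uxy : uniq [:: x; y] by rewrite /= inE neq_xy.
have [t [Ut pet_t t_closed]] :=
  search_sound GP7 GC7 GC4 Gdiamond Gprivate Uxy searchxy.
apply: (is_petersen_iso Ut) => //.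
(* [is_petersen] requires 10 vertices, so [t] is not empty; being closed under adjacency, it is all
   of the connected graph [G]. *)
have [x0 tx0] : exists x0, x0 \in t.
  by case: (t) pet_t => // x0 t' _; exists x0; exact: mem_head.
exact: connected_subset_full Gconn tx0 t_closed.
Qed.
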